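(* Let $\mathcal A$ be an associative unital algebra over $\mathbb C$ and let $K_1,K_2,K_3\in\mathcal A$ satisfy the relations of the Askey--Wilson algebra $AW(3)$: $$[K_1,K_2]=K_3,$$ $$[K_2,K_3]=2\rho K_2K_1K_2+a_1(K_1K_2+K_2K_1)+a_2K_2^2+c_1K_1+dK_2+g_1,$$ $$[K_3,K_1]=2\rho K_1K_2K_1+a_2(K_1K_2+K_2K_1)+a_1K_1^2+c_2K_2+dK_1+g_2,$$ with constants $\rho,a_1,a_2,c_1,c_2,d,g_1,g_2\in\mathbb C$. Then these relations can be rewritten as $[K_1,K_2]=K_3$ together with $$[K_2,[K_2,K_1]]=R_2(K_2)K_1+R_1(K_2)K_3+R_0(K_2),$$ $$[K_1,[K_1,K_2]]=S_2(K_1)K_2+S_1(K_1)K_3+S_0(K_1),$$ where $$R_2(x)=-2\rho x^2-2a_1x-c_1,\quad R_1(x)=-2\rho x-a_1,\quad R_0(x)=-a_2x^2-dx-g_1,$$ $$S_2(x)=-2\rho x^2-2a_2x-c_2,\quad S_1(x)=2\rho x+a_2,\quad S_0(x)=-a_1x^2-dx-g_2 .$$ In particular $AW(3)$ is a quasi-linear algebra of type $(2,1)$, with basic operators (Hamiltonians) $K_1,K_2$ and the single extension operator $K_3$.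
   Context: $[A,B]=AB-BA$. A quasi-linear algebra of type $(2,1)$ with basic operators $X_1,X_2$ and single extension operator $Y$ means: for each $i\in\{1,2\}$, with $k\ne i$ the other index, both commutators $[X_i,X_k]$ and $[X_i,Y]$ are of the form $p_1(X_i)X_k+p_2(X_i)Y+p_0(X_i)$ for some polynomials $p_0,p_1,p_2$ (depending on $i$ and on the commutator). *)

(* Defs.v *)
From mathcomp Require Import all_boot all_order all_algebra.
Set Implicit Arguments.
Unset Strict Implicit.
Unset Printing Implicit Defensive.
Import GRing.Theory.
Local Open Scope ring_scope.

Definition bracket (A : pzRingType) (x y : A) : A := x * y - y * x.

Definition AW3_relations (C : comNzRingType) (A : algType C)
    (rho a1 a2 c1 c2 d g1 g2 : C) (K1 K2 K3 : A) : Prop :=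
  [/\ bracket K1 K2 = K3,
      bracket K2 K3 = (2 * rho) *: (K2 * K1 * K2) + a1 *: (K1 * K2 + K2 * K1)
                      + a2 *: K2 ^+ 2 + c1 *: K1 + d *: K2 + g1%:A
    & bracket K3 K1 = (2 * rho) *: (K1 * K2 * K1) + a2 *: (K1 * K2 + K2 * K1)
                      + a1 *: K1 ^+ 2 + c2 *: K2 + d *: K1 + g2%:A].

(* The coefficients multiply the operators on the left: the algebra is not
   commutative, so the side matters. *)
Definition quasi_linear_comb (C : comNzRingType) (A : algType C)
    (p1 p2 p0 : {poly C}) (x z y : A) : A :=
  horner_alg x p1 * z + horner_alg x p2 * y + horner_alg x p0.

(* X lists the two basic operators and Y is the extension operator. *)
Definition quasi_linear21 (C : comNzRingType) (A : algType C)
    (X : 2.-tuple A) (Y : A) : Prop :=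
  forall i k : 'I_2, k != i ->
    (exists p1 p2 p0 : {poly C},
       bracket (tnth X i) (tnth X k)
         = quasi_linear_comb p1 p2 p0 (tnth X i) (tnth X k) Y) /\
    (exists p1 p2 p0 : {poly C},
       bracket (tnth X i) Y
         = quasi_linear_comb p1 p2 p0 (tnth X i) (tnth X k) Y).

(* Main.v *)
Require Import Defs.
From mathcomp Require Import all_boot all_order all_algebra.
From mathcomp Require Import complex reals.
Set Implicit Arguments.
Unset Strict Implicit.
Unset Printing Implicit Defensive.
Import GRing.Theory.
Local Open Scope ring_scope.

(** Moving every power of x to the left of z by z x = x z + [z,x] turns x z x and z x + x z into
    expressions linear in z and [z,x], with coefficients polynomial in x. This is
    [symmetric_quasi_linear], valid for any x and z. Hence, once K3 = [K1,K2], each defining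
    relation and its rewritten form are the same equation up to an overall sign. The identity is
    used at (x,z) = (K2,K1) and, with a1 and a2 exchanged, at (K1,K2); there [z,x] is K3 and -K3
    respectively, whence the opposite signs in R1 and S1. Quasi-linearity follows by reading off
    coefficients. *)

(* Substituting z x - x z for the commutator makes x^2 z cancel between the
   first two summands on the right and leaves the cubic term x z x. *)
Lemma symmetric_quasi_linear (C : comNzRingType) (A : algType C)
    (r a b c d g : C) (x z : A) :
  - ((2 * r) *: (x * z * x) + a *: (z * x + x * z) + b *: x ^+ 2
     + c *: z + d *: x + g%:A)
  = horner_alg x (- (2 * r) *: 'X^2 - (2 * a) *: 'X - c%:P) * z
    + horner_alg x (- (2 * r) *: 'X - a%:P) * (z * x - x * z)
    + horner_alg x (- b *: 'X^2 - d *: 'X - g%:P).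
Proof.
have alg_cst e y : horner_alg x e%:P * y = e *: y.
  by rewrite horner_algC -scalerAl mul1r.
have alg_scale e p : horner_alg x (e *: p) = e *: horner_alg x p.
  by rewrite -mul_polyC rmorphM /= horner_algC mulr_algl.
rewrite !rmorphB /= !alg_scale rmorphXn /= !horner_algX.
rewrite !mulrBl !alg_cst -!scalerAl expr2 !scaleNr !mulrBr !mulrA !scalerBr.
set p := (2 * r) *: (x * x * z); set q := (2 * r) *: _.
(* One of the two copies of a x z cancels against the commutator term; the other completes z x + x
   z. *)
have -> : (2 * a) *: (x * z) = a *: (x * z) + a *: (x * z).
  by rewrite mulr_natl mulr2n scalerDl.
rewrite scalerDr; set u := a *: (z * x); set v := a *: (x * z).
set b' := b *: _; set c' := c *: z; set d' := d *: x; set g' := g%:A.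
(* The terms in x alone agree on both sides; what remains is the part containing z, where [p]
   cancels. *)
suff -> : - p - (v + v) - c' + (- (q - p) - (u - v)) = - (q + (u + v) + c').
  rewrite horner_algC -!opprD; congr (- _); rewrite !addrA.
  by rewrite [q + u + v + _ + _]addrAC.
rewrite -!opprD; congr (- _); rewrite [LHS]addrAC; congr (_ + _).
by rewrite addrACA subrKC; congr (_ + _); rewrite addrC addrA subrK.
Qed.

Lemma bracketN (A : pzRingType) (x y : A) : bracket x (- y) = - bracket x y.
Proof. by rewrite /bracket mulrN mulNr opprB opprK addrC. Qed.

Lemma bracket_antisym (A : pzRingType) (x y : A) : bracket x y = - bracket y x.
Proof. by rewrite /bracket opprB. Qed.

Theorem mainTheorem3 (R : realType) (A : algType R[i])
    (rho a1 a2 c1 c2 d g1 g2 : R[i]) (K1 K2 K3 : A) :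
  let R2 : {poly R[i]} := - (2 * rho) *: 'X^2 - (2 * a1) *: 'X - c1%:P in
  let R1 : {poly R[i]} := - (2 * rho) *: 'X - a1%:P in
  let R0 : {poly R[i]} := - a2 *: 'X^2 - d *: 'X - g1%:P in
  let S2 : {poly R[i]} := - (2 * rho) *: 'X^2 - (2 * a2) *: 'X - c2%:P in
  let S1 : {poly R[i]} := (2 * rho) *: 'X + a2%:P in
  let S0 : {poly R[i]} := - a1 *: 'X^2 - d *: 'X - g2%:P in
  (AW3_relations rho a1 a2 c1 c2 d g1 g2 K1 K2 K3 <->
   [/\ bracket K1 K2 = K3,
       bracket K2 (bracket K2 K1)
         = horner_alg K2 R2 * K1 + horner_alg K2 R1 * K3 + horner_alg K2 R0
     & bracket K1 (bracket K1 K2)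
         = horner_alg K1 S2 * K2 + horner_alg K1 S1 * K3 + horner_alg K1 S0])
  /\ (AW3_relations rho a1 a2 c1 c2 d g1 g2 K1 K2 K3 ->
      quasi_linear21 [tuple K1; K2] K3).
Proof.
move=> R2 R1 R0 S2 S1 S0.
have rw : AW3_relations rho a1 a2 c1 c2 d g1 g2 K1 K2 K3 <->
   [/\ bracket K1 K2 = K3,
       bracket K2 (bracket K2 K1)
         = horner_alg K2 R2 * K1 + horner_alg K2 R1 * K3 + horner_alg K2 R0
     & bracket K1 (bracket K1 K2)
         = horner_alg K1 S2 * K2 + horner_alg K1 S1 * K3 + horner_alg K1 S0].
  (* At x = K1 the commutator [z,x] is [K2,K1] = -[K1,K2], and [S1] absorbs this sign. *)
  have S1E : horner_alg K1 S1 * bracket K1 K2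
      = horner_alg K1 (- (2 * rho) *: 'X - a2%:P) * (K2 * K1 - K1 * K2).
    by rewrite -[K2 * K1 - _]/(bracket K2 K1) (bracket_antisym K2) mulrN -mulNr
       -rmorphN opprB scaleNr opprK addrC.
  have e2 := symmetric_quasi_linear rho a1 a2 c1 d g1 K2 K1.
  have e1 := symmetric_quasi_linear rho a2 a1 c2 d g2 K1 K2.
  rewrite -S1E [K2 * K1 + _]addrC in e1.
  (* With [K3] eliminated, [e2] and [e1] serve both directions; the converse compares negated
     sides. *)
  split=> -[<- h2 h1]; split=> //.
  - by rewrite (bracket_antisym K2 K1) bracketN h2 e2.
  - by rewrite bracket_antisym h1 e1.
  - by apply: oppr_inj; rewrite e2 -h2 -bracketN -bracket_antisym.
  - by apply: oppr_inj; rewrite e1 -h1 -bracket_antisym.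
split=> // /rw[e12 e2 e1] i k.
have e21 : bracket K2 K1 = - K3 by rewrite bracket_antisym e12.
have lin (x z y : A) (e : R[i]) : quasi_linear_comb 0 e%:P 0 x z y = e *: y.
  by rewrite /quasi_linear_comb !rmorph0 mul0r add0r addr0 horner_algC
             -scalerAl mul1r.
have neg (x z y : A) (p2 p1 p0 : {poly R[i]}) :
    quasi_linear_comb (- p2) (- p1) (- p0) x z y
    = - quasi_linear_comb p2 p1 p0 x z y.
  by rewrite /quasi_linear_comb !rmorphN !mulNr !opprD.
(* Only (i,k) = (0,1) and (1,0) survive [k != i], giving two commutators each. *)
case: i k => [[|[|//]] ?] [[|[|//]] ?] //= _; rewrite !(tnth_nth 0) /=; split.
- by exists 0, 1%:P, 0; rewrite lin scale1r.
- by exists S2, S1, S0; rewrite /quasi_linear_comb -e1 e12.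
- by exists 0, (- 1)%:P, 0; rewrite lin scaleN1r.
(* The coefficients are negated because [K2,K3] = -[K2,[K2,K1]]. *)
- by exists (- R2), (- R1), (- R0); rewrite neg /quasi_linear_comb -e2 e21
     bracketN opprK.
Qed.
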